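(* Let $T$ be a tree on $n\geq 4$ vertices that is not a path, let $M=(T)_{\mathrm{res}}$ be the matroid on ground set $V(T)$ whose independent sets are the subsets of minimal resolving sets of $T$, and let $M^*$ be its dual matroid. Then $M^*$ is loop-free.
   Context: For a connected graph $G$, $d(u,v)$ is the shortest-path distance. $R\subseteq V(G)$ is a resolving set if for any two distinct vertices $u,w$ there is $h\in R$ with $d(u,h)\neq d(w,h)$; it is minimal if no proper subset of it is resolving. The bases of $M$ are the minimal resolving sets of $T$. The dual matroid $M^*$ is the matroid on $V(T)$ whose bases are the complements $V(T)\setminus B$ of the bases $B$ of $M$. A loop is an element $x$ such that $\{x\}$ is dependent (equivalently, $x$ lies in no basis). *)

(* Defs.v *)
From mathcomp Require Import all_boot.

Set Implicit Arguments.
Unset Strict Implicit.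
Unset Printing Implicit Defensive.

Section Graphs.

Variables (V : finType) (e : rel V).

Definition simple_graph : Prop := symmetric e /\ irreflexive e.

Definition connected_graph : Prop := forall x y : V, connect e x y.

(* A cycle has at least three vertices: for symmetric e, [:: x; y] is an
   e-cycle as soon as x and y are adjacent. *)
Definition acyclic_graph : Prop :=
  forall c : seq V, 2 < size c -> ~~ ucycleb e c.

Definition is_tree : Prop :=
  [/\ simple_graph, connected_graph & acyclic_graph].

Definition is_path_graph : Prop :=
  exists2 f : V -> 'I_#|V|, bijective f
    & forall x y, e x y = ((f x).+1 == f y) || ((f y).+1 == f x).

Definition walk_of_length (u v : V) (k : nat) : bool :=
  [exists p : k.-tuple V, path e u p && (last u p == v)].

(* The least length of a walk from u to v; the junk value #|V| is taken
   exactly when u and v are not connected. *)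
Definition dist (u v : V) : nat := find (walk_of_length u v) (iota 0 #|V|).

Definition resolving (R : {set V}) : bool :=
  [forall u, forall w, (u != w) ==> [exists h in R, dist u h != dist w h]].

Definition minimal_resolving (R : {set V}) : bool := minset resolving R.

Lemma walk_of_lengthP u v k :
  reflect (exists p : seq V, [/\ path e u p, last u p = v & size p = k])
          (walk_of_length u v k).
Proof.
apply: (iffP existsP) => [[p /andP[pp /eqP lp]]|[p [pp lp sp]]].
  by exists p; rewrite size_tuple.
by move/eqP: sp => sp; exists (Tuple sp); rewrite /= pp lp eqxx.
Qed.

Lemma dist_walk u v : connect e u v -> walk_of_length u v (dist u v).
Proof.
move=> /connectP[p0 /shortenP[p pp up _] vE].
have sp : size p < #|V| by rewrite -[_.+1]/(size (u :: p)) -(card_uniqP up) max_card.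
have hasw : has (walk_of_length u v) (iota 0 #|V|).
  apply/hasP; exists (size p); first by rewrite mem_iota.
  by apply/walk_of_lengthP; exists p.
have := nth_find 0 hasw; rewrite nth_iota ?add0n //.
by move: hasw; rewrite has_find size_iota.
Qed.

Lemma dist_min u v k : walk_of_length u v k -> dist u v <= k.
Proof.
move=> wk; rewrite leqNgt; apply/negP => lt_k.
have ltV : k < #|V|.
  apply: leq_trans lt_k _.
  by have := find_size (walk_of_length u v) (iota 0 #|V|); rewrite size_iota.
by have := before_find 0 lt_k; rewrite nth_iota // add0n wk.
Qed.

End Graphs.

Record matroid (V : finType) := Matroid {
  indep : {set {set V}};
  indep0 : set0 \in indep;
  indepS : forall I J : {set V}, I \subset J -> J \in indep -> I \in indep;
  indep_aug : forall I J : {set V}, I \in indep -> J \in indep -> #|I| < #|J| ->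
    exists2 x, x \in J :\: I & x |: I \in indep
}.

Section Matroids.

Variables (V : finType).
Implicit Types (M : matroid V) (I J B : {set V}) (x : V).

Definition basis M B : bool := maxset [in indep M] B.

Definition is_loop M x : bool := [set x] \notin indep M.

Definition loop_free M : Prop := forall x, ~~ is_loop M x.

Lemma basis_indep M B : basis M B -> B \in indep M.
Proof. exact: maxsetp. Qed.

Lemma basis_card_ge M B I : basis M B -> I \in indep M -> #|I| <= #|B|.
Proof.
move=> bB iI; rewrite leqNgt; apply/negP => lt.
have [x] := indep_aug (basis_indep bB) iI lt.
rewrite inE => /andP[xB _] /(maxsetsup bB)/(_ (subsetUr _ _)) E.
by move: xB; rewrite -E setU11.
Qed.

Lemma indep_extend M I B : I \in indep M -> basis M B ->
  exists B', [/\ basis M B', I \subset B' & B' \subset I :|: B].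
Proof.
move=> iI bB.
pose P J := [&& J \in indep M, I \subset J & J \subset I :|: B].
have PI : P I by rewrite /P iI subxx subsetUl.
have [B' mB' sIB'] := maxset_exists PI.
have /and3P[iB' _ sB'] := maxsetp mB'.
exists B'; split=> //.
have cB' : #|B| <= #|B'|.
  rewrite leqNgt; apply/negP => lt.
  have [x] := indep_aug iB' (basis_indep bB) lt.
  rewrite inE => /andP[xB' xB] ix.
  have Px : P (x |: B').
    rewrite /P ix (subset_trans sIB') ?subsetUr //= subUset sB' andbT.
    by rewrite sub1set inE xB orbT.
  by have E := maxsetsup mB' Px (subsetUr _ _); rewrite -E setU11 in xB'.
apply/maxsetP; split=> // C iC sC; apply/esym/eqP.
by rewrite eqEcard sC (leq_trans (basis_card_ge bB iC)).
Qed.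

Lemma basis_exists M I : I \in indep M -> exists2 B, basis M B & I \subset B.
Proof. by move=> iI; have [B] := @maxset_exists _ [in indep M] I iI; exists B. Qed.

Definition dual_indep M : {set {set V}} :=
  [set I : {set V} | [exists B, basis M B && (I \subset ~: B)]].

Lemma dual_indepP M I :
  reflect (exists2 B, basis M B & I \subset ~: B) (I \in dual_indep M).
Proof.
rewrite inE; apply: (iffP existsP) => [[B /andP[]]|[B bB sB]]; first by exists B.
by exists B; rewrite bB.
Qed.

Lemma dual_indep0 M : set0 \in dual_indep M.
Proof.
have [B bB _] := basis_exists (indep0 M).
by apply/dual_indepP; exists B; rewrite ?sub0set.
Qed.

Lemma dual_indepS M I J :
  I \subset J -> J \in dual_indep M -> I \in dual_indep M.
Proof.
move=> sIJ /dual_indepP[B bB sJ]; apply/dual_indepP; exists B => //.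
exact: subset_trans sJ.
Qed.

Lemma dual_indep_aug M I J :
  I \in dual_indep M -> J \in dual_indep M -> #|I| < #|J| ->
  exists2 x, x \in J :\: I & x |: I \in dual_indep M.
Proof.
move=> /dual_indepP[B' bB' sI] /dual_indepP[B bB sJ] lt.
have iBI : B :\: I \in indep M by apply: indepS (basis_indep bB); apply: subsetDl.
have [C [bC sBC sC]] := indep_extend iBI bB'.
have IC : I \subset ~: C.
  apply/subsetP => x xI; rewrite inE; apply/negP => /(subsetP sC).
  by rewrite !inE xI /= => xB'; move: (subsetP sI _ xI); rewrite inE xB'.
have [|/subsetPn[x xJ xC]] := boolP (J :\: I \subset C); last first.
  exists x => //; apply/dual_indepP; exists C => //.
  by rewrite subUset IC sub1set inE xC.
move=> sJC; exfalso.
have JB x : x \in J -> x \in B = false.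
  by move/(subsetP sJ); rewrite inE => /negbTE.
have dJB : (B :\: I) :&: (J :\: I) = set0.
  apply/setP => x; rewrite !inE; case: (boolP (x \in J)) => [/JB->|_];
    by rewrite ?andbF.
have dI : (B :&: I) :&: (J :&: I) = set0.
  apply/setP => x; rewrite !inE; case: (boolP (x \in J)) => [/JB->|_];
    by rewrite ?andbF.
have h1 : #|B :\: I| + #|J :\: I| <= #|B|.
  rewrite -cardsUI dJB cards0 addn0.
  apply: leq_trans (basis_card_ge bB (basis_indep bC)).
  by apply: subset_leq_card; rewrite subUset sBC.
have h2 : #|B :&: I| + #|J :&: I| <= #|I|.
  rewrite -cardsUI dI cards0 addn0; apply: subset_leq_card.
  by rewrite subUset !subsetIr.
have: #|B| + #|J| <= #|B| + #|I|.
  rewrite -(cardsID I B) -(cardsID I J) addnACA addnC.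
  by rewrite (cardsID I B) leq_add.
by rewrite leq_add2l leqNgt lt.
Qed.

Definition dual M : matroid V :=
  Matroid (@dual_indep0 M) (@dual_indepS M) (@dual_indep_aug M).

Lemma basis_dual M B : basis (dual M) B = basis M (~: B).
Proof.
apply/idP/idP => [bB|bB].
  have /dual_indepP[C bC sB] := basis_indep bB.
  have iC : ~: C \in indep (dual M) by apply/dual_indepP; exists C.
  by rewrite -(maxsetsup bB iC sB) setCK.
apply/maxsetP; split; first by apply/dual_indepP; exists (~: B); rewrite ?setCK.
move=> C /dual_indepP[D bD sC] sB.
have sDB : D \subset ~: B by rewrite subsetC; apply: subset_trans sC.
have E : D = ~: B.
  apply/eqP; rewrite eqEcard sDB.
  exact: (basis_card_ge bD (basis_indep bB)).
by apply/eqP; rewrite eqEsubset sB andbT -(setCK B) -E.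
Qed.

End Matroids.

Definition resolving_matroid (V : finType) (e : rel V) (M : matroid V) : Prop :=
  forall I : {set V},
    I \in indep M <-> exists2 B, minimal_resolving e B & I \subset B.

(* Main.v *)
Require Import Defs.
From mathcomp Require Import all_boot.

(** A vertex [u] distinguishes itself from every other vertex, being the only
    one at distance 0 from [u].  Of two distinct vertices at most one is [x],
    so the complement of [x] is always resolving; a minimal resolving set
    inside it is a basis of the resolving matroid avoiding [x]. *)

Lemma dist_eq0 (V : finType) (e : rel V) (u v : V) :
  connected_graph e -> (dist e u v == 0) = (u == v).
Proof.
move=> ce; apply/eqP/eqP => [d0|->].
  have := dist_walk (ce u v); rewrite d0.
  by case/walk_of_lengthP => p [_ <- /size0nil ->].
apply/eqP; rewrite -leqn0; apply: dist_min.
by apply/walk_of_lengthP; exists [::].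
Qed.

Lemma resolving_setC1 (V : finType) (e : rel V) (x : V) :
  connected_graph e -> resolving e (~: [set x]).
Proof.
move=> ce; apply/forallP => u; apply/forallP => w; apply/implyP => uw.
have [ux|ux] := eqVneq u x; apply/exists_inP.
  (* Here [u = x] is excluded as a witness, but [w] differs from [x] and is at distance 0 from
     itself alone. *)
  exists w; first by rewrite !inE -ux eq_sym.
  by rewrite (eqP (_ : dist e w w == 0)) dist_eq0.
exists u; first by rewrite !inE.
by rewrite (eqP (_ : dist e u u == 0)) ?dist_eq0 // eq_sym dist_eq0 // eq_sym.
Qed.

(** An independent [C] containing [B] lies in some minimal resolving [B']. As [B] resolves and lies
    in [B'], minimality of [B'] forces [B = B'], which squeezes [C] to [B]. *)
Lemma minimal_resolving_basis (V : finType) (e : rel V) (M : matroid V)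
    (B : {set V}) :
  resolving_matroid e M -> minimal_resolving e B -> basis M B.
Proof.
move=> hM mB; apply/maxsetP; split; first by apply/hM; exists B.
move=> C /hM[B' mB' sCB'] sBC; apply/eqP; rewrite eqEsubset sBC andbT.
by rewrite (minsetinf mB' (minsetp mB) (subset_trans sBC sCB')).
Qed.

Theorem theorem4 (V : finType) (T : rel V) (M : matroid V)
  (hT : is_tree T) (hn : 4 <= #|V|) (hpath : ~ is_path_graph T)
  (hM : resolving_matroid T M) :
  loop_free (dual M).
Proof.
case: hT => _ cT _ x; rewrite negbK.
have [B mB sB] := minset_exists (resolving_setC1 V T x cT).
(* Since [B] avoids [x], its complement contains [x]. *)
apply/dual_indepP; exists B; last by rewrite subsetC.
exact: minimal_resolving_basis hM mB.
Qed.
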